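(* Suppose data graphs are restricted to have maximum degree at most $\Delta$ (where $\Delta$ may be a function of the number of edges $m$), and let $S$ be a connected sample graph with $p\ge 2$ nodes. Then there is a serial algorithm that, given any such data graph $G$ with $m$ edges, enumerates all instances of $S$ in $G$, each exactly once, in running time $O(m\,\Delta^{p-2})$.
   Context: Graphs are finite, simple and undirected. The sample graph $S$ is fixed, and constants hidden in $O(\cdot)$ may depend on $S$ (and $p$) but not on the data graph $G$ or on $\Delta$. An instance of $S$ in $G$ is a (not necessarily induced) subgraph of $G$ isomorphic to $S$. It is assumed that $G$ has been preprocessed with an index that tests in $O(1)$ time whether two given nodes are adjacent, and an index that lists the neighbors of a node in time proportional to its degree; both indexes can be built in $O(m)$ time, and the cost of building them is neglected. *)

(* Defs.v *)
From mathcomp Require Import all_boot.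

Set Implicit Arguments.
Unset Strict Implicit.
Unset Printing Implicit Defensive.

(* Finite simple undirected graphs with node set 'I_n. *)
Record sgraph (n : nat) := SGraph {
  adj : rel 'I_n;
  adj_sym : symmetric adj;
  adj_irr : irreflexive adj
}.

Definition nbrs n (G : sgraph n) (x : 'I_n) : {set 'I_n} := [set y | adj G x y].

Definition edges n (G : sgraph n) : {set {set 'I_n}} :=
  [set [set x; y] | x in [set: 'I_n], y in nbrs G x].

Definition nb_edges n (G : sgraph n) : nat := #|edges G|.

Definition maxdeg n (G : sgraph n) : nat := \max_(x < n) #|nbrs G x|.

Definition connected n (G : sgraph n) : Prop :=
  0 < n /\ forall x y : 'I_n, connect (adj G) x y.

(* A pair (nodes, edges), each edge being a set of nodes. *)
Definition subgr (n : nat) := ({set 'I_n} * {set {set 'I_n}})%type.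

Definition is_subgraph n (G : sgraph n) (H : subgr n) : bool :=
  (H.2 \subset edges G) && [forall e in H.2, e \subset H.1].

Definition is_isomorphic p n (S : sgraph p) (H : subgr n) : bool :=
  [exists f : {ffun 'I_p -> 'I_n},
    [&& injectiveb f, f @: [set: 'I_p] == H.1 &
        [forall i, forall j, adj S i j == ([set f i; f j] \in H.2)]]].

Definition instances p n (S : sgraph p) (G : sgraph n) : {set subgr n} :=
  [set H | is_subgraph G H && is_isomorphic S H].

(* The data graph as an algorithm receives it: a list with one entry per edge,
   in arbitrary order and orientation, and an index giving the neighbors of
   each node in arbitrary order. *)
Record presentation n (G : sgraph n) := Presentation {
  elist : seq ('I_n * 'I_n);
  nlist : 'I_n -> seq 'I_n;
  elistP : perm_eq [seq [set e.1; e.2] | e <- elist] (enum (edges G));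
  nlistP : forall x, perm_eq (nlist x) (enum (nbrs G x))
}.

(* The two indexes on machine words; words that are not node names have no
   neighbors. *)
Definition adj_index n (G : sgraph n) (u v : nat) : bool :=
  if (insub u : option 'I_n) is Some x then
    if (insub v : option 'I_n) is Some y then adj G x y else false
  else false.

Definition nbr_index n (G : sgraph n) (I : presentation G) (u : nat) : seq nat :=
  if (insub u : option 'I_n) is Some x then map val (nlist I x) else [::].

(* The serial machine: a unit-cost random access machine with registers, a
   memory with indirect addressing, and access to the two indexes, programmed
   by structured commands.  Arithmetic is restricted to addition and truncated
   subtraction, so that unit cost does not hide the manipulation of very long
   words. *)
Notation reg := nat (only parsing).

Inductive instr : Type :=
| Nop
| Const (d : reg) (k : nat)
| Move (d a : reg)
| Add (d a b : reg)
| Sub (d a b : reg)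
| Read (d a : reg)              (* d := mem[a] *)
| Write (a b : reg)             (* mem[a] := b *)
| Adjacent (d a b : reg)        (* d := 1 if nodes a and b are adjacent, else 0 *)
| Neighbors (d a b : reg)       (* copies the neighbors of node b to mem[a],
                                   mem[a+1], and so on; d := their number *)
| Emit (rs : seq reg).          (* outputs the tuple of the contents of rs *)

Inductive cmd : Type :=
| Do (i : instr)
| Seq (c1 c2 : cmd)
| IfLt (a b : reg) (c1 c2 : cmd)
| WhileLt (a b : reg) (c : cmd).

Record state := State {
  regs : nat -> nat;
  mem : nat -> nat;
  out : seq (seq nat)
}.

Definition upd (f : nat -> nat) (a v : nat) : nat -> nat :=
  fun x => if x == a then v else f x.

Definition upd_seq (f : nat -> nat) (a : nat) (vs : seq nat) : nat -> nat :=
  fun x => if a <= x < a + size vs then nth 0 vs (x - a) else f x.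

Definition set_reg (s : state) (d v : nat) : state :=
  State (upd (regs s) d v) (mem s) (out s).

Definition step n (G : sgraph n) (I : presentation G) (i : instr) (s : state) :
    state :=
  let r := regs s in
  match i with
  | Nop => s
  | Const d k => set_reg s d k
  | Move d a => set_reg s d (r a)
  | Add d a b => set_reg s d (r a + r b)
  | Sub d a b => set_reg s d (r a - r b)
  | Read d a => set_reg s d (mem s (r a))
  | Write a b => State r (upd (mem s) (r a) (r b)) (out s)
  | Adjacent d a b => set_reg s d (adj_index G (r a) (r b))
  | Neighbors d a b =>
      let vs := nbr_index I (r b) in
      State (upd r d (size vs)) (upd_seq (mem s) (r a) vs) (out s)
  | Emit rs => State r (mem s) (rcons (out s) (map r rs))
  end.

Definition cost n (G : sgraph n) (I : presentation G) (i : instr) (s : state) :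
    nat :=
  match i with
  | Neighbors _ _ b => (size (nbr_index I (regs s b))).+1
  | Emit rs => (size rs).+1
  | _ => 1
  end.

(* [exec I c s t s']: run from state s, the command c halts in state s' after
   time t.  Each evaluation of a test costs 1. *)
Inductive exec n (G : sgraph n) (I : presentation G) :
    cmd -> state -> nat -> state -> Prop :=
| ExecDo i s :
    exec I (Do i) s (cost I i s) (step I i s)
| ExecSeq c1 c2 s s1 s2 t1 t2 :
    exec I c1 s t1 s1 -> exec I c2 s1 t2 s2 ->
    exec I (Seq c1 c2) s (t1 + t2) s2
| ExecIf a b c1 c2 s s1 t :
    exec I (if regs s a < regs s b then c1 else c2) s t s1 ->
    exec I (IfLt a b c1 c2) s t.+1 s1
| ExecWhileEnd a b c s :
    ~~ (regs s a < regs s b) ->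
    exec I (WhileLt a b c) s 1 s
| ExecWhileLoop a b c s s1 s2 t1 t2 :
    regs s a < regs s b ->
    exec I c s t1 s1 -> exec I (WhileLt a b c) s1 t2 s2 ->
    exec I (WhileLt a b c) s (t1 + t2).+1 s2.

Lemma exec_det n (G : sgraph n) (I : presentation G) c s t1 s1 t2 s2 :
  exec I c s t1 s1 -> exec I c s t2 s2 -> t1 = t2 /\ s1 = s2.
Proof.
move=> H; elim: H t2 s2 => {c s t1 s1}.
- by move=> i s t2 s2 H; inversion H.
- move=> c1 c2 s s1 s1' t t' _ IH1 _ IH2 t2 s2 H.
  inversion H as [|? ? ? r1 ? u1 u2 E1 E2| | |]; subst.
  by case: (IH1 _ _ E1) => ? ?; subst; case: (IH2 _ _ E2) => -> ->.
- move=> a b c1 c2 s s1 t _ IH t2 s2 H.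
  inversion H as [| |? ? ? ? ? ? u E| |]; subst.
  by case: (IH _ _ E) => -> ->.
- move=> a b c s /negP Hn t2 s2 H.
  by inversion H.
- move=> a b c s s1 s1' t t' Hlt _ IH1 _ IH2 t2 s2 H.
  inversion H as [| | |? ? ? ? Hn|? ? ? ? r1 ? u1 u2 _ E1 E2]; subst.
    by rewrite Hlt in Hn.
  by case: (IH1 _ _ E1) => ? ?; subst; case: (IH2 _ _ E2) => -> ->.
Qed.

(* Initially mem[0] is the number m of edges, and mem[1], ..., mem[2m] hold the
   endpoints of the listed edges; everything else is 0. *)
Definition init n (G : sgraph n) (I : presentation G) : state :=
  State (fun=> 0)
        (nth 0 (size (elist I) ::
                flatten [seq [:: val e.1; val e.2] | e <- elist I]))
        [::].

Definition node_tuple p n (f : {ffun 'I_p -> 'I_n}) : seq nat :=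
  [seq val (f i) | i <- enum 'I_p].

(* The subgraph denoted by the tuple (f 0, ..., f (p - 1)). *)
Definition image_graph p n (S : sgraph p) (f : {ffun 'I_p -> 'I_n}) : subgr n :=
  (f @: [set: 'I_p], [set f @: e | e : {set 'I_p} in edges S]).

(* The output consists of p-tuples of nodes whose denoted subgraphs are the
   instances of S in G, each occurring exactly once. *)
Definition enumerates p n (S : sgraph p) (G : sgraph n) (o : seq (seq nat)) :
    Prop :=
  exists2 fs : seq {ffun 'I_p -> 'I_n},
    o = [seq node_tuple f | f <- fs] &
    perm_eq [seq image_graph S f | f <- fs] (enum (instances S G)).

(* Main.v *)
(** List the nodes of [S] as [v_0, v_1, ...] so that every later node is
    adjacent to an earlier one.  Guess the images of [v_0] and [v_1] among the
    [2m] arcs of [G], and then the image of each further node among the at most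
    [Delta] neighbors of the image of an earlier one: this gives at most
    [2m Delta^(p-2)] maps, among which are all embeddings of [S], and each of
    them is checked in constant time.  Embeddings with the same image differ by
    an automorphism of [S]; only the lexicographically smallest one is output. *)

Require Import Defs.
From mathcomp Require Import all_boot zify.

Set Implicit Arguments.
Unset Strict Implicit.
Unset Printing Implicit Defensive.

(** * The lexicographic order on words *)

Fixpoint lexle (u v : seq nat) : bool :=
  match u, v with
  | x :: u', y :: v' => (x < y) || (x == y) && lexle u' v'
  | [::], _ => true
  | _, [::] => false
  end.

Lemma lexle_refl : reflexive lexle.
Proof. by elim=> //= x u ->; rewrite eqxx orbT. Qed.

Lemma lexle_total : total lexle.
Proof. by elim=> [|x u IH] [|y v] //=; case: ltngtP => //= _; apply: IH. Qed.

Lemma lexle_trans : transitive lexle.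
Proof.
elim=> [|y v IH] [|x u] [|z w] //= /orP[xy|/andP[/eqP-> uv]]; last first.
  by case/orP=> [->//|/andP[-> /(IH _ _ uv)->]]; rewrite orbT.
by case/orP=> [yz|/andP[/eqP<- _]]; rewrite ?(ltn_trans xy yz) ?xy.
Qed.

Lemma lexle_anti : antisymmetric lexle.
Proof.
elim=> [|x u IH] [|y v] //=.
by case: ltngtP => //= -> /IH->.
Qed.

(** * Edges as pairs of adjacent nodes *)

Lemma mem_edges n (G : sgraph n) x y : ([set x; y] \in edges G) = adj G x y.
Proof.
apply/imset2P/idP => [[a b _]|xy]; last by exists x y; rewrite ?inE.
rewrite inE => ab E.
(* If [x = y], then [a] and [b] both lie in a singleton, so [G] would have a loop. *)
have : x != y.
  apply: contraTneq ab => xy; move: E; rewrite xy setUid => /setP E.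
  have /set1P-> : a \in [set y] by rewrite E set21.
  have /set1P-> : b \in [set y] by rewrite E set22.
  by rewrite adj_irr.
have := set21 x y; have := set22 x y; rewrite {}E => /set2P[]-> /set2P[]->.
- by rewrite eqxx.
- by rewrite adj_sym.
- by [].
- by rewrite eqxx.
Qed.

Lemma edgesP n (G : sgraph n) (e : {set 'I_n}) :
  reflect (exists x y, adj G x y /\ e = [set x; y]) (e \in edges G).
Proof.
apply: (iffP idP) => [/imset2P[x y _]|[x [y [xy ->]]]]; last by rewrite mem_edges.
by rewrite inE => xy ->; exists x, y.
Qed.

(** * Embeddings, automorphisms and least representatives *)

Section Representatives.

Variables (p n : nat) (S : sgraph p) (G : sgraph n).
Implicit Types (f g : {ffun 'I_p -> 'I_n}) (s : {ffun 'I_p -> 'I_p}).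

Definition embedding f : bool :=
  injectiveb f && [forall i, forall j, adj S i j ==> adj G (f i) (f j)].

Definition automorphism s : bool :=
  injectiveb s && [forall i, forall j, adj S (s i) (s j) == adj S i j].

Definition representative f : bool :=
  embedding f &&
  [forall s, automorphism s ==>
     lexle (node_tuple f) (node_tuple [ffun i => f (s i)])].

Lemma embeddingP f :
  reflect (injective f /\ forall i j, adj S i j -> adj G (f i) (f j)) (embedding f).
Proof.
apply: (iffP andP) => -[/injectiveP fI H]; split=> //.
  by move=> i j; move: H => /forallP/(_ i)/forallP/(_ j)/implyP.
by apply/forallP=> i; apply/forallP=> j; apply/implyP/H.
Qed.

Lemma mem_image_graph f i j :
  injective f -> ([set f i; f j] \in (image_graph S f).2) = adj S i j.
Proof.
move=> fI; rewrite -mem_edges -(mem_imset _ _ (imset_inj fI)).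
by rewrite imsetU !imset_set1.
Qed.

Lemma image_graph_instance f : embedding f -> image_graph S f \in instances S G.
Proof.
case/embeddingP => fI fE; rewrite inE; apply/andP; split.
  apply/andP; split.
    apply/subsetP=> _ /imsetP[e /edgesP[x [y [xy ->]]] ->].
    by rewrite imsetU !imset_set1 mem_edges fE.
  by apply/forall_inP=> _ /imsetP[e _ ->]; apply/imsetS/subsetT.
apply/existsP; exists f; rewrite eqxx; apply/andP; split; first exact/injectiveP.
by apply/forallP=> i; apply/forallP=> j; rewrite mem_image_graph.
Qed.

(** The isomorphism from [S] onto [H] is itself the embedding. Every edge of [H] comes from [S]:
    being an edge of [G] it is a pair, and both ends are images under [f]. *)
Lemma instance_image_graph H :
  H \in instances S G -> exists2 f, embedding f & image_graph S f = H.
Proof.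
case: H => V E; rewrite inE => /andP[/andP[/= /subsetP EG /forall_inP EV]].
case/existsP=> f /and3P[/injectiveP fI /eqP /= fV fE].
have {}fE i j : adj S i j = ([set f i; f j] \in E).
  by move: fE => /forallP/(_ i)/forallP/(_ j)/eqP.
exists f; first by apply/embeddingP; split=> // i j; rewrite fE => /EG; rewrite mem_edges.
congr pair => //; apply/setP=> e; apply/imsetP/idP.
  case=> _ /edgesP[i [j [ij ->]]] ->; rewrite imsetU !imset_set1 -fE //.
move=> eE; have /edgesP[x [y [_ De]]] := EG _ eE.
have := EV _ eE; rewrite De subUset !sub1set -fV => /andP[/imsetP[i _ Dx] /imsetP[j _ Dy]].
exists [set i; j]; last by rewrite imsetU !imset_set1 Dx Dy.
by rewrite mem_edges fE -Dx -Dy -De.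
Qed.

(** As the node images agree, [s j] can be the node that [f] sends to [g j]. It respects adjacency
    both ways because [f] and [g] read it off the same edge set. *)
Lemma image_graph_eq f g :
    injective f -> injective g -> image_graph S f = image_graph S g ->
  exists2 s, automorphism s & g = [ffun i => f (s i)].
Proof.
move=> fI gI fg.
have /fin_all_exists[s sP] j : exists i, g j = f i.
  have : g j \in (image_graph S f).1 by rewrite fg imset_f.
  by case/imsetP=> i _ ->; exists i.
exists (finfun s); last by apply/ffunP=> i; rewrite !ffunE.
apply/andP; split.
  by apply/injectiveP=> i j; rewrite !ffunE => sE; apply: gI; rewrite !sP sE.
apply/forallP=> i; apply/forallP=> j; rewrite !ffunE.
by rewrite -(mem_image_graph _ _ fI) -!sP fg mem_image_graph.
Qed.

(** An injective self-map of a finite set is invertible; the inverse shows that [s] maps the nodes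
    and the edges of [S] onto themselves. *)
Lemma image_graph_aut f s :
  automorphism s -> image_graph S [ffun i => f (s i)] = image_graph S f.
Proof.
case/andP=> /injectiveP sI /forallP sE.
have [s' sK s'K] := injF_bij sI.
have simg (A : {set 'I_p}) : [ffun i => f (s i)] @: A = f @: (s @: A).
  by rewrite -imset_comp; apply: eq_imset => i; rewrite ffunE.
have sT : s @: [set: 'I_p] = [set: 'I_p].
  by apply/setP=> i; rewrite inE -[i]s'K imset_f.
have sS : [set s @: e | e : {set 'I_p} in edges S] = edges S.
  apply/setP=> e; apply/imsetP/edgesP.
    case=> _ /edgesP[i [j [ij ->]]] ->; rewrite imsetU !imset_set1.
    by exists (s i), (s j); move/forallP/(_ j)/eqP: (sE i) => ->.
  case=> i [j [ij ->]]; exists [set s' i; s' j]; last by rewrite imsetU !imset_set1 !s'K.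
  by rewrite mem_edges; move/forallP/(_ (s' j))/eqP: (sE (s' i)) => <-; rewrite !s'K.
congr pair; rewrite /image_graph /=; first by rewrite simg sT.
rewrite -[in RHS]sS -imset_comp; apply: eq_imset => e.
exact: simg.
Qed.

Lemma node_tuple_inj : injective (@node_tuple p n).
Proof.
move=> f g /eq_in_map fg; apply/ffunP=> i.
by apply/val_inj/fg; rewrite mem_enum.
Qed.

(** Each map is the other composed with an automorphism, so each tuple is at most the other, and
    antisymmetry applies. *)
Lemma representative_uniq f g :
    representative f -> representative g -> image_graph S f = image_graph S g ->
  f = g.
Proof.
case/andP=> /embeddingP[fI _] /forallP fP /andP[/embeddingP[gI _] /forallP gP] fg.
have [s sA gE] := image_graph_eq fI gI fg.
have [s' s'A fE] := image_graph_eq gI fI (esym fg).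
apply/node_tuple_inj/lexle_anti; have := implyP (fP s) sA; rewrite -gE => ->.
by have := implyP (gP s') s'A; rewrite -fE.
Qed.

(** Among the finitely many embeddings with image [H], take one with the least tuple. Composing it
    with an automorphism stays in this class, so minimality gives the required inequalities. *)
Lemma representative_exists H :
  H \in instances S G -> exists2 f, representative f & image_graph S f = H.
Proof.
case/instance_image_graph=> f0 f0E f0H.
pose P f := embedding f && (image_graph S f == H).
have Pf0 : P f0 by rewrite /P f0E f0H eqxx.
have [f /andP[fE /eqP fH] fmin] := @extremumP _ _ lexle f0 P (@node_tuple p n)
  lexle_refl lexle_trans lexle_total Pf0.
exists f => //; rewrite /representative fE; apply/forallP=> s; apply/implyP=> sA.
apply: fmin; rewrite /P image_graph_aut // fH eqxx andbT.
case/andP: sA => /injectiveP sI /forallP sS.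
case/embeddingP: fE => fI fS; apply/embeddingP; split=> [i j|i j ij].
  by rewrite !ffunE => /fI/sI.
by rewrite !ffunE; apply: fS; move/forallP/(_ j)/eqP: (sS i) => ->.
Qed.

(** Representatives are in bijection with instances, so correctness reduces to a statement about
    tuples alone. *)
Lemma enumerates_representatives (o : seq (seq nat)) :
    uniq o ->
    (forall w, w \in o <-> exists2 f, representative f & w = node_tuple f) ->
  enumerates S G o.
Proof.
move=> o_uniq oP.
have [fs Do] : exists fs : seq {ffun 'I_p -> 'I_n}, o = [seq node_tuple f | f <- fs].
  have : forall w, w \in o -> exists f : {ffun 'I_p -> 'I_n}, w = node_tuple f.
    by move=> w /oP[f _ ->]; exists f.
  elim: (o) => [|w o' IH] oT; first by exists [::].
  have [|fs ->] := IH; first by move=> v vo; apply: oT; rewrite inE vo orbT.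
  by have [f ->] := oT w (mem_head _ _); exists (f :: fs).
have fsP f : (f \in fs) = representative f.
  rewrite -(mem_map node_tuple_inj) -Do; apply/idP/idP => [/oP[g gR /node_tuple_inj->]//|fR].
  by apply/oP; exists f.
exists fs => //; apply: uniq_perm.
- rewrite map_inj_in_uniq; first by move: o_uniq; rewrite Do map_inj_uniq //; apply: node_tuple_inj.
  by move=> f g; rewrite !fsP; apply: representative_uniq.
- exact: enum_uniq.
- move=> H; rewrite mem_enum; apply/mapP/idP => [[f]|/representative_exists[f fR <-]].
    by rewrite fsP => /andP[fE _] ->; apply: image_graph_instance.
  by exists f; rewrite ?fsP.
Qed.

End Representatives.

(** * A connected search order and the backtracking search along it *)

(** The list grows from [x0]. If no edge leaves the chosen nodes, they are closed under adjacency,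
    so by connectedness they are all nodes, which is impossible while fewer than [p] are chosen. *)
Lemma search_order p (S : sgraph p) (x0 : 'I_p) :
    (forall x y : 'I_p, connect (adj S) x y) ->
  exists vs : seq 'I_p, [/\ uniq vs, size vs = p &
    forall k, 0 < k < p -> exists2 q, q < k & adj S (nth x0 vs q) (nth x0 vs k)].
Proof.
move=> S_conn.
suffices H m : m < p -> exists vs : seq 'I_p, [/\ uniq vs, size vs = m.+1 &
    forall k, 0 < k < m.+1 -> exists2 q, q < k & adj S (nth x0 vs q) (nth x0 vs k)].
  have p_gt0 : 0 < p by apply: leq_ltn_trans (ltn_ord x0).
  by have := H p.-1; rewrite prednK //; apply.
elim: m => [_|m IH lt_m]; first by exists [:: x0]; split=> // -[|[]].
have [vs [vs_uniq vs_size vsP]] := IH (ltnW lt_m).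
have [[x y] /= /and3P[xv yv xy]|cl] :=
  pickP [pred e : 'I_p * 'I_p | [&& e.1 \in vs, e.2 \notin vs & adj S e.1 e.2]].
  exists (rcons vs y); split; rewrite ?rcons_uniq ?yv ?size_rcons ?vs_size //.
  move=> k /andP[k_gt0]; rewrite ltnS leq_eqVlt => /orP[/eqP->|lt_k].
    exists (index x vs); first by rewrite -vs_size index_mem.
    by rewrite !nth_rcons index_mem xv vs_size ltnn eqxx nth_index.
  have [|q lt_q] := vsP k; rewrite ?k_gt0 // => qk; exists q => //.
  by rewrite !nth_rcons vs_size lt_k (ltn_trans lt_q lt_k).
have vs_closed : closed (adj S) (mem vs).
  move=> x y xy; have := cl (x, y); have := cl (y, x).
  by rewrite /= (adj_sym S y x) xy !andbT; do 2!case: (_ \in vs).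
have vs_all y : y \in vs.
  have hv : head x0 vs \in vs by rewrite -nth0 mem_nth ?vs_size.
  by rewrite -(closed_connect vs_closed (S_conn (head x0 vs) y)).
have := uniq_leq_size (enum_uniq 'I_p) (fun y _ => vs_all y).
by rewrite size_enum_ord vs_size leqNgt lt_m.
Qed.

(* [pars] lists, for each position still to be filled, the earlier position whose
   value must have the new value among its neighbors. *)
Fixpoint search (nb : nat -> seq nat) (pars : seq nat) (xs : seq nat) :
    seq (seq nat) :=
  if pars is q :: pars' then
    flatten [seq search nb pars' (rcons xs z) | z <- nb (nth 0 xs q)]
  else [:: xs].

(** Used to see that distinct prefixes of equal length lead to disjoint results. *)
Lemma search_prefix nb pars xs ys :
    ys \in search nb pars xs ->
  size ys = size xs + size pars /\ take (size xs) ys = xs.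
Proof.
elim: pars xs => [|q pars IH] xs /=.
  by rewrite inE addn0 => /eqP->; rewrite take_size.
case/flatten_mapP=> z _ /IH[]; rewrite size_rcons addSnnS => ys_size ys_take.
split=> //; rewrite -(take_takel ys (leqnSn (size xs))) ys_take.
by rewrite -cats1 take_size_cat.
Qed.

(** The induction fixes one more entry at a time; the bound on [nth 0 pars k] keeps the parent
    position inside the prefix already built. *)
Lemma mem_search nb pars ys i :
    size ys = i + size pars ->
    (forall k, k < size pars -> nth 0 pars k < i + k) ->
    (forall k, k < size pars -> nth 0 ys (i + k) \in nb (nth 0 ys (nth 0 pars k))) ->
  ys \in search nb pars (take i ys).
Proof.
elim: pars i => [|q pars IH] i /=.
  by rewrite addn0 => <-; rewrite take_size inE.
move=> ys_size ltq ysP; have lt_i : i < size ys by rewrite ys_size -addSnnS leq_addr.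
have lt_q : q < i by have := ltq 0 isT; rewrite addn0.
apply/flatten_mapP; exists (nth 0 ys i).
  by have := ysP 0 isT; rewrite addn0 nth_take.
rewrite -take_nth //; apply: IH => [|k lt_k|k lt_k]; first by rewrite addSnnS.
  by rewrite addSnnS; apply: (ltq k.+1).
by rewrite addSnnS; apply: (ysP k.+1).
Qed.

Lemma uniq_flatten_map (T U : eqType) (t : T -> seq U) (s : seq T) :
    uniq s -> {in s, forall x, uniq (t x)} ->
    {in s &, forall x y z, z \in t x -> z \in t y -> x = y} ->
  uniq (flatten [seq t x | x <- s]).
Proof.
elim: s => //= x s IH /andP[xs s_uniq] t_uniq t_inj.
rewrite cat_uniq t_uniq ?mem_head //=; apply/andP; split.
  apply/hasPn=> z /flatten_mapP[y ys zy]; apply: contra xs => zx.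
  by rewrite (t_inj x y _ _ z) ?mem_head // inE ys orbT.
apply: IH => // [y ys|y z ys zs]; first by apply: t_uniq; rewrite inE ys orbT.
by apply: t_inj; rewrite inE ?ys ?zs orbT.
Qed.

Lemma search_uniq nb pars xs : (forall u, uniq (nb u)) -> uniq (search nb pars xs).
Proof.
move=> nb_uniq; elim: pars xs => //= q pars IH xs.
apply: uniq_flatten_map => // y z _ _ ys /search_prefix[_ yP] /search_prefix[_].
by rewrite size_rcons -(size_rcons xs y) yP => /rcons_inj[].
Qed.

(** * The neighbor index and the arcs of a presented graph *)

Section Presentation.

Variables (n : nat) (G : sgraph n) (I : presentation G).

Lemma adj_indexE (x y : 'I_n) : adj_index G x y = adj G x y.
Proof. by rewrite /adj_index !valK. Qed.

Lemma nbr_index_uniq u : uniq (nbr_index I u).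
Proof.
rewrite /nbr_index; case: insubP => // x _ _.
by rewrite map_inj_uniq ?(perm_uniq (nlistP I x)) ?enum_uniq //; apply: val_inj.
Qed.

Lemma mem_nbr_index (x y : 'I_n) : (val y \in nbr_index I x) = adj G x y.
Proof.
rewrite /nbr_index valK mem_map; last exact: val_inj.
by rewrite (perm_mem (nlistP I x)) mem_enum inE.
Qed.

Lemma size_nbr_index u : size (nbr_index I u) <= maxdeg G.
Proof.
rewrite /nbr_index; case: insubP => // x _ _.
rewrite size_map (perm_size (nlistP I x)) -cardE.
exact: (leq_bigmax (F := fun x => #|nbrs G x|) x).
Qed.

Lemma size_elist : size (elist I) = nb_edges G.
Proof. by have := perm_size (elistP I); rewrite size_map -cardE. Qed.

Definition arcs : seq (seq nat) :=
  flatten [seq [:: [:: val e.1; val e.2]; [:: val e.2; val e.1]] | e <- elist I].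

Lemma elist_adj e : e \in elist I -> adj G e.1 e.2.
Proof.
move=> eI; rewrite -mem_edges -mem_enum -(perm_mem (elistP I)).
by apply/mapP; exists e.
Qed.

Lemma mem_arcs (x y : 'I_n) : adj G x y -> [:: val x; val y] \in arcs.
Proof.
move=> xy; have neq_xy : x != y by apply: contraTneq xy => ->; rewrite adj_irr.
have : [set x; y] \in enum (edges G) by rewrite mem_enum mem_edges.
rewrite -(perm_mem (elistP I)) => /mapP[[a b] abI /= /setP E].
apply/flatten_mapP; exists (a, b) => //=.
move: neq_xy; have := E x; have := E y; rewrite !inE !eqxx orbT /=.
by case/esym/orP=> /eqP-> /esym/orP[]/eqP->; rewrite ?eqxx ?orbT.
Qed.

Lemma arcs_uniq : uniq arcs.
Proof.
have : uniq [seq [set e.1; e.2] | e <- elist I].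
  by rewrite (perm_uniq (elistP I)) enum_uniq.
move=> E_uniq; have := E_uniq => /map_uniq el_uniq.
apply: uniq_flatten_map => // [e /elist_adj ee|e e' eI eI' z].
  rewrite /= andbT inE; apply: contraTneq ee => -[/val_inj-> _].
  by rewrite adj_irr.
move=> ze ze'; apply/eqP.
(* Equality of edges is reduced to equality of positions in [elist I], which can be tested on the
   duplicate-free list of unordered pairs. *)
rewrite -(nth_index e eI) -(nth_index e eI') nth_uniq ?index_mem //.
have ss : [set e.1; e.2] = [set e'.1; e'.2].
  move: ze ze'; rewrite !inE.
  by case/orP=> /eqP-> /orP[]/eqP[/val_inj-> /val_inj->] //; rewrite setUC.
rewrite -(nth_uniq [set e.1; e.2] _ _ E_uniq) ?size_map ?index_mem //.
by rewrite !(nth_map e) ?index_mem // !nth_index // ss.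
Qed.

End Presentation.

(** * Tests recognizing representatives, and correctness of the search *)

(* The arguments of a test are positions in the search order. *)
Inductive test : Type :=
| Neq (i j : nat)
| Adj (i j : nat)
| Lex (u v : seq nat).

Definition holds n (G : sgraph n) (xs : seq nat) (c : test) : bool :=
  match c with
  | Neq i j => nth 0 xs i != nth 0 xs j
  | Adj i j => adj_index G (nth 0 xs i) (nth 0 xs j)
  | Lex u v => lexle [seq nth 0 xs i | i <- u] [seq nth 0 xs i | i <- v]
  end.

Definition well_formed p (c : test) : bool :=
  match c with
  | Neq i j | Adj i j => (i < p) && (j < p)
  | Lex u v => all (ltn^~ p) u && all (ltn^~ p) v
  end.

Section Search.

Variables (p : nat) (S : sgraph p) (x0 : 'I_p) (vs : seq 'I_p).
Hypotheses (p_gt1 : 1 < p) (vs_uniq : uniq vs) (vs_size : size vs = p).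
Hypothesis vsP :
  forall k, 0 < k < p -> exists2 q, q < k & adj S (nth x0 vs q) (nth x0 vs k).

(** The three blocks express injectivity, preservation of edges and minimality under automorphisms.
    The list depends only on [S] and [vs], so the tests can be hard-wired into the program. *)
Definition tests : seq test :=
  [seq Neq (index e.1 vs) (index e.2 vs) | e : 'I_p * 'I_p in [pred e | e.1 != e.2]] ++
  [seq Adj (index e.1 vs) (index e.2 vs) | e : 'I_p * 'I_p in [pred e | adj S e.1 e.2]] ++
  [seq Lex [seq index i vs | i <- enum 'I_p] [seq index (s i) vs | i <- enum 'I_p]
     | s : {ffun 'I_p -> 'I_p} in automorphism S].

(** Candidates are written in search order, output tuples in the order of the nodes of [S]. *)
Definition word (xs : seq nat) : seq nat :=
  [seq nth 0 xs (index j vs) | j <- enum 'I_p].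

(** Starts at position 2, since an arc fills positions 0 and 1. The first neighbor found in [vs]
    lies at an earlier position by [vsP]. *)
Definition parents : seq nat :=
  [seq find (fun v => adj S v (nth x0 vs k)) vs | k <- iota 2 (p - 2)].

Lemma mem_vs j : j \in vs.
Proof.
have [||_ ->] := uniq_min_size vs_uniq (s2 := enum 'I_p); rewrite ?mem_enum //.
  by move=> y; rewrite mem_enum.
by rewrite size_enum_ord vs_size.
Qed.

Lemma index_vs_lt j : index j vs < p.
Proof. by rewrite -[p in _ < p]vs_size index_mem mem_vs. Qed.

Lemma tests_well_formed : all (well_formed p) tests.
Proof.
rewrite !all_cat !all_map; apply/and3P; split; apply/allP=> e _ /=.
- by rewrite !index_vs_lt.
- by rewrite !index_vs_lt.
- by rewrite !all_map; apply/andP; split; apply/allP=> j _; apply: index_vs_lt.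
Qed.

Lemma tests_representative n (G : sgraph n) (xs : seq nat) (f : {ffun 'I_p -> 'I_n}) :
    (forall j, nth 0 xs (index j vs) = f j) ->
  all (holds G xs) tests = representative S G f.
Proof.
move=> xsf; rewrite !all_cat !all_map andbA; congr (_ && _); first congr (_ && _).
- apply/allP/injectiveP => [H i j fij|fI e]; last first.
    by rewrite mem_enum /= !xsf => ne; apply: contra ne => /eqP/val_inj/fI->.
  apply: contraTeq isT => ij.
  by have := H (i, j); rewrite mem_enum /= !xsf fij eqxx; apply.
- apply/allP/forallP => [H i|H e].
    apply/forallP=> j; apply/implyP=> ij.
    by have := H (i, j); rewrite mem_enum /= !xsf adj_indexE; apply.
  rewrite mem_enum /= !xsf adj_indexE.
  by move: (H e.1) => /forallP/(_ e.2)/implyP.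
have E s : holds G xs (Lex [seq index i vs | i <- enum 'I_p]
                          [seq index (s i) vs | i <- enum 'I_p])
         = lexle (node_tuple f) (node_tuple [ffun i => f (s i)]).
  rewrite /= /node_tuple -!map_comp; congr (lexle _ _); apply: eq_map => i /=.
    exact: xsf.
  by rewrite ffunE; apply: xsf.
apply/allP/forallP => [H s|H s].
  by apply/implyP=> sA; rewrite -E; apply: H; rewrite mem_enum.
by rewrite mem_enum => sA; rewrite /preim /= in sA *; have := implyP (H s) sA; rewrite -E.
Qed.

(** Every node of [S] has a neighbor, so each position occurs in some [Adj] test, and [adj_index]
    fails on words that are not node names. *)
Lemma tests_node_tuple n (G : sgraph n) (xs : seq nat) :
    all (holds G xs) tests ->
  exists f : {ffun 'I_p -> 'I_n}, forall j, nth 0 xs (index j vs) = f j.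
Proof.
rewrite !all_cat !all_map => /and3P[_ /allP H _].
have /fin_all_exists[f fP] j : exists x : 'I_n, nth 0 xs (index j vs) = x.
  have [i ij] : exists i, adj S i j.
    have := nth_index x0 (mem_vs j); case Dk: (index j vs) => [|k] <-.
      (* The root is adjacent to the node at position 1, whose earlier neighbor can only be at
         position 0. *)
      have [|q] := vsP (k := 1); first by rewrite p_gt1.
      by case: q => // _ jk; exists (nth x0 vs 1); rewrite adj_sym.
    have [|q _ qj] := vsP (k := k.+1); first by rewrite /= -Dk index_vs_lt.
    by exists (nth x0 vs q).
  have : holds G xs (Adj (index i vs) (index j vs)).
    by apply: (H (i, j)); rewrite mem_enum.
  rewrite /= /adj_index; case: insubP => // y _ _; case: insubP => // z _ <- _.
  by exists z.
by exists (finfun f) => j; rewrite ffunE.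
Qed.

Section Correctness.

Variables (n : nat) (G : sgraph n) (I : presentation G).

Definition candidates : seq (seq nat) :=
  flatten [seq search (nbr_index I) parents xs | xs <- arcs I].

Lemma size_parents : size parents = p - 2.
Proof. by rewrite size_map size_iota. Qed.

Lemma parentsP k : k < p - 2 ->
  nth 0 parents k < 2 + k /\
  adj S (nth x0 vs (nth 0 parents k)) (nth x0 vs (2 + k)).
Proof.
move=> lt_k; rewrite (nth_map 0) ?size_iota // nth_iota //.
have [|q lt_q qk] := vsP (k := 2 + k); first by rewrite /=; lia.
have le_q : find (fun v => adj S v (nth x0 vs (2 + k))) vs <= q.
  by rewrite leqNgt; apply/negP => /(before_find x0); rewrite qk.
split; first exact: leq_ltn_trans lt_q.
apply: (@nth_find _ x0 (fun v => adj S v (nth x0 vs (2 + k)))).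
by apply/(has_nthP x0); exists q => //; rewrite vs_size; lia.
Qed.

Lemma candidates_size xs : xs \in candidates -> size xs = p.
Proof.
case/flatten_mapP=> a aI /search_prefix[-> _]; rewrite size_parents.
suff -> : size a = 2 by lia.
by case/flatten_mapP: aI => e _; rewrite !inE => /orP[]/eqP->.
Qed.

Lemma candidates_uniq : uniq candidates.
Proof.
apply: uniq_flatten_map; first exact: arcs_uniq.
  by move=> a _; apply/search_uniq/nbr_index_uniq.
have sz2 a : a \in arcs I -> size a = 2.
  by case/flatten_mapP=> e _; rewrite !inE => /orP[]/eqP->.
move=> a b /sz2 sa /sz2 sb z /search_prefix[_ <-] /search_prefix[_ <-].
by rewrite sa sb.
Qed.

Lemma word_inj : {in [pred xs | size xs == p] &, injective word}.
Proof.
move=> xs ys; rewrite !inE => /eqP xs_size /eqP ys_size /eq_in_map E.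
apply: (@eq_from_nth _ 0) => [|k]; rewrite xs_size ?ys_size // => lt_k.
have := E (nth x0 vs k); rewrite mem_enum index_uniq ?vs_size //; exact.
Qed.

Lemma embedding_candidate (f : {ffun 'I_p -> 'I_n}) :
  embedding S G f -> [seq val (f j) | j <- vs] \in candidates.
Proof.
case/embeddingP=> _ fE; set xs := map _ _.
have xs_size : size xs = p by rewrite size_map.
have xsE k : k < p -> nth 0 xs k = f (nth x0 vs k).
  by move=> lt_k; rewrite (nth_map x0) ?vs_size.
have take2 : take 2 xs = [:: val (f (nth x0 vs 0)); val (f (nth x0 vs 1))].
  have xs_gt1 : 1 < size xs by rewrite xs_size.
  move: (xsE 0 (ltnW p_gt1)) (xsE 1 p_gt1) xs_gt1.
  by case: (xs) => [|y [|z zs]] //= -> ->; rewrite take0.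
apply/flatten_mapP; exists (take 2 xs).
  rewrite take2; apply/mem_arcs/fE; have [|[|q] // _ qE] := vsP (k := 1).
  by rewrite p_gt1.
apply: mem_search; rewrite size_parents ?xs_size; first lia.
  by move=> k /parentsP[].
move=> k lt_k; have [lt_q qk] := parentsP lt_k.
rewrite !xsE; try lia.
by rewrite mem_nbr_index; apply: fE.
Qed.

(** Candidates passing the tests are representatives; conversely a representative is an embedding,
    hence a candidate. Repetitions are excluded because [word] is injective on candidates. *)
Lemma candidates_enumerate :
  enumerates S G [seq word xs | xs <- candidates & all (holds G xs) tests].
Proof.
apply: enumerates_representatives.
  rewrite map_inj_in_uniq ?filter_uniq ?candidates_uniq // => xs ys.
  rewrite !mem_filter => /andP[_ /candidates_size xs_size].
  by case/andP=> _ /candidates_size ys_size; apply: word_inj; rewrite inE ?xs_size ?ys_size.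
have wordE xs (f : {ffun 'I_p -> 'I_n}) :
    (forall j, nth 0 xs (index j vs) = f j) -> word xs = node_tuple f.
  by move=> E; apply: eq_map.
move=> w; split=> [/mapP[xs]|[f fR ->]].
  rewrite mem_filter => /andP[ok _] ->; have [f fP] := tests_node_tuple ok.
  by exists f; [rewrite -(tests_representative G fP) | apply: wordE].
have fP j : nth 0 [seq val (f j) | j <- vs] (index j vs) = f j.
  by rewrite (nth_map x0) ?index_mem ?mem_vs // nth_index ?mem_vs.
apply/mapP; exists [seq val (f j) | j <- vs]; last by rewrite (wordE _ f).
rewrite mem_filter (tests_representative G fP) fR.
by apply: embedding_candidate; case/andP: fR.
Qed.

End Correctness.

End Search.

(** * A program logic with time bounds and output *)

(** A total-correctness triple: [T] bounds the time, and [ws] is exactly what is appended to the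
    output. *)
Definition runs n (G : sgraph n) (I : presentation G) (c : cmd) (s : state)
    (T : nat) (ws : seq (seq nat)) (Q : state -> Prop) : Prop :=
  exists t s', [/\ exec I c s t s', t <= T, out s' = out s ++ ws & Q s'].

Definition frame (r b : nat) (s s' : state) : Prop :=
  (forall k, k < r -> regs s' k = regs s k) /\
  (forall a, a < b -> Defs.mem s' a = Defs.mem s a).

(* Node number [i] of the search order is kept in register [val_reg i].  From
   the third node on, the list of its possible values ends before the address
   in [end_reg i] and starts at the address in [end_reg i.-1], so that the lists
   of the nested loops form a stack; [pos_reg i] runs through the list.
   Registers 0 and 1 hold the constants 0 and 1. *)
Definition val_reg (i : nat) : nat := 3 * i + 2.
Definition pos_reg (i : nat) : nat := 3 * i + 3.
Definition end_reg (i : nat) : nat := 3 * i + 4.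

Definition vals (i : nat) (s : state) : seq nat :=
  [seq regs s (val_reg j) | j <- iota 0 i].

Lemma nth_vals i s j : j < i -> nth 0 (vals i s) j = regs s (val_reg j).
Proof. by move=> lt_j; rewrite (nth_map 0) ?size_iota // nth_iota. Qed.

(** The slack of 2 is harmless: the last register read is numbered [val_reg i - 3]. *)
Lemma vals_frame i r b s s' : frame r b s s' -> val_reg i <= r + 2 -> vals i s' = vals i s.
Proof.
case=> fr _ le_r; apply/eq_in_map => j; rewrite mem_iota /= add0n => lt_j.
by apply: fr; move: le_r; rewrite /val_reg; lia.
Qed.

Lemma valsS i s : vals i.+1 s = rcons (vals i s) (regs s (val_reg i)).
Proof. by rewrite /vals -addn1 iotaD map_cat cats1. Qed.

Lemma frame_trans r b s1 s2 s3 : frame r b s1 s2 -> frame r b s2 s3 -> frame r b s1 s3.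
Proof.
case=> r12 m12 [r23 m23]; split=> k lt_k; first by rewrite r23 ?r12.
by rewrite m23 ?m12.
Qed.

Section Runs.

Variables (n : nat) (G : sgraph n) (I : presentation G).

Lemma runs_weaken c s T T' ws (Q Q' : state -> Prop) :
  runs I c s T ws Q -> T <= T' -> (forall s', Q s' -> Q' s') -> runs I c s T' ws Q'.
Proof.
case=> t [s' [ex le_t os Qs]] le_T QQ'.
by exists t, s'; split=> //; [apply: leq_trans le_T | apply: QQ'].
Qed.

Lemma runs_leq c s T T' ws (Q : state -> Prop) :
  T <= T' -> runs I c s T ws Q -> runs I c s T' ws Q.
Proof. by move=> le_T H; apply: runs_weaken H _ _. Qed.

Lemma runs_do i s T (Q : state -> Prop) :
    cost I i s <= T -> out (step I i s) = out s -> Q (step I i s) ->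
  runs I (Do i) s T [::] Q.
Proof.
move=> le_T os Qs; exists (cost I i s), (step I i s).
by split=> //; [apply: ExecDo | rewrite os cats0].
Qed.

Lemma runs_seq c1 c2 s T1 T2 w1 w2 (Q1 Q2 : state -> Prop) :
    runs I c1 s T1 w1 Q1 -> (forall s1, Q1 s1 -> runs I c2 s1 T2 w2 Q2) ->
  runs I (Seq c1 c2) s (T1 + T2) (w1 ++ w2) Q2.
Proof.
case=> t1 [s1 [ex1 le1 os1 Q1s1]] /(_ _ Q1s1)[t2 [s2 [ex2 le2 os2 Q2s2]]].
exists (t1 + t2), s2; split=> //; first exact: ExecSeq ex1 ex2.
  exact: leq_add.
by rewrite os2 os1 catA.
Qed.

Lemma runs_do_seq i c s T ws (Q : state -> Prop) :
    out (step I i s) = out s -> runs I c (step I i s) T ws Q ->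
  runs I (Seq (Do i) c) s (cost I i s + T) ws Q.
Proof.
move=> os H; apply: (@runs_seq _ _ _ _ _ [::] _ (eq (step I i s))); last by move=> s1 <-.
exact: runs_do.
Qed.

Lemma runs_if a b c1 c2 s T ws (Q : state -> Prop) :
  runs I (if regs s a < regs s b then c1 else c2) s T ws Q ->
  runs I (IfLt a b c1 c2) s T.+1 ws Q.
Proof.
by case=> t [s' [ex le_t os Qs]]; exists t.+1, s'; split=> //; apply: ExecIf.
Qed.

(** The list of items still to be treated indexes the invariant and serves as the variant. Each
    round pays 1 for its test, and the final 1 is the failing test. *)
Lemma runs_while (A : Type) (inv : seq A -> state -> Prop) (w : A -> seq (seq nat)) K a b c :
    (forall s, inv [::] s -> regs s b <= regs s a) ->
    (forall z zs s, inv (z :: zs) s ->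
       regs s a < regs s b /\ runs I c s K (w z) (inv zs)) ->
  forall zs s, inv zs s ->
  runs I (WhileLt a b c) s ((size zs * K.+1).+1) (flatten [seq w z | z <- zs]) (inv [::]).
Proof.
move=> stop go; elim=> [|z zs IH] s inv_s.
  exists 1, s; split; rewrite ?cats0 //.
  by apply: ExecWhileEnd; rewrite -leqNgt stop.
have [lt_ab [t1 [s1 [ex1 le1 os1 inv1]]]] := go _ _ _ inv_s.
have [t2 [s2 [ex2 le2 os2 inv2]]] := IH _ inv1.
exists (t1 + t2).+1, s2; split=> //; first exact: ExecWhileLoop ex2.
  by rewrite ltnS /= mulSn addSnnS leq_add.
by rewrite os2 os1 /= catA.
Qed.

End Runs.

(** * Compiling the tests *)

Fixpoint guard_lex (u v : seq nat) (c : cmd) : cmd :=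
  match u, v with
  | i :: u', j :: v' =>
      IfLt (val_reg i) (val_reg j) c
        (IfLt (val_reg j) (val_reg i) (Do Nop) (guard_lex u' v' c))
  | [::], _ => c
  | _, [::] => Do Nop
  end.

(** Register [val_reg p] lies beyond the values at positions below [p] and serves as scratch.
    Copying [c] enlarges the program, but not its running time. *)
Definition guard (p : nat) (e : test) (c : cmd) : cmd :=
  match e with
  | Neq i j =>
      IfLt (val_reg i) (val_reg j) c (IfLt (val_reg j) (val_reg i) c (Do Nop))
  | Adj i j =>
      Seq (Do (Adjacent (val_reg p) (val_reg i) (val_reg j)))
          (IfLt 0 (val_reg p) c (Do Nop))
  | Lex u v => guard_lex u v c
  end.

Definition guard_cost (e : test) : nat := if e is Lex u _ then 3 * size u else 3.

Section Guards.

Variables (p n : nat) (G : sgraph n) (I : presentation G).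

(** The bound [b] is arbitrary because the checking code leaves the memory alone. *)
Definition outputs_if (c : cmd) (B : seq nat -> bool) (K : nat) (w : seq nat -> seq nat) :
    Prop :=
  forall s b, regs s 0 = 0 ->
  runs I c s K (if B (vals p s) then [:: w (vals p s)] else [::])
       (frame (val_reg p) b s).

Lemma runs_nop s T r b : 0 < T -> runs I (Do Nop) s T [::] (frame r b s).
Proof. by move=> T_gt0; apply: runs_do. Qed.

Lemma outputs_guard_lex u v c B K w :
    0 < K -> all (ltn^~ p) u && all (ltn^~ p) v -> outputs_if c B K w ->
  outputs_if (guard_lex u v c) (fun xs => holds G xs (Lex u v) && B xs) (3 * size u + K) w.
Proof.
move=> K_gt0; elim: u v => [|i u IH] [|j v] //=.
  by move=> _ _ s b s0; apply: runs_nop; lia.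
case/andP=> /andP[lt_i us] /andP[lt_j uv] Hc s b s0.
have {}IH := IH v; rewrite us uv in IH; have {}IH := IH isT Hc s b s0.
rewrite !nth_vals //.
apply: (@runs_leq _ _ _ _ _ (3 * size u + K).+2); first lia.
apply: runs_if; case: ltngtP => [lt_ij|lt_ji|eq_ij] /=.
- by apply: (runs_leq _ (Hc s b s0)); lia.
- by apply: runs_if; rewrite lt_ji; apply: runs_nop; lia.
- by apply: runs_if; rewrite eq_ij ltnn.
Qed.

Lemma outputs_guard e c B K w :
    0 < K -> well_formed p e -> outputs_if c B K w ->
  outputs_if (guard p e c) (fun xs => holds G xs e && B xs) (guard_cost e + K) w.
Proof.
move=> K_gt0; case: e => [i j|i j|u v] /=; last exact: outputs_guard_lex.
- case/andP=> lt_i lt_j Hc s b s0; rewrite !nth_vals //.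
  apply: (@runs_leq _ _ _ _ _ K.+2); first lia.
  apply: runs_if; case: ltngtP => [lt_ij|lt_ji|eq_ij] /=.
  + by apply: (runs_leq _ (Hc s b s0)); lia.
  + by apply: runs_if; rewrite lt_ji; apply: Hc.
  + by apply: runs_if; rewrite eq_ij ltnn; apply: runs_nop.
- case/andP=> lt_i lt_j Hc s b s0; rewrite !nth_vals //.
  apply: (@runs_leq _ _ _ _ _ (1 + K.+1)); first lia.
  apply: runs_do_seq => //=.
  set s1 := set_reg _ _ _.
  have fr1 : frame (val_reg p) b s s1.
    by split=> // k lt_k; rewrite /= /upd ltn_eqF.
  have s10 : regs s1 0 = 0 by rewrite fr1.1 // /val_reg; lia.
  apply: runs_if; rewrite s10 /= /upd eqxx lt0b.
  rewrite -(vals_frame fr1) ?leq_addr //; case: ifP => _ /=.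
    by apply: (runs_weaken (Hc s1 b s10)) => // s'; apply: frame_trans.
  by apply: runs_do.
Qed.

Lemma outputs_guards es c B K w :
    0 < K -> all (well_formed p) es -> outputs_if c B K w ->
  outputs_if (foldr (guard p) c es) (fun xs => all (holds G xs) es && B xs)
             (sumn (map guard_cost es) + K) w.
Proof.
move=> K_gt0; elim: es => //= e es IH /andP[e_wf es_wf] Hc s b s0.
rewrite -andbA -addnA; have sum_gt0 : 0 < sumn (map guard_cost es) + K by lia.
exact: (outputs_guard sum_gt0 e_wf (IH es_wf Hc)).
Qed.

End Guards.

(** * The nested loops over neighbor lists *)

(** [Neighbors] pushes a list on the stack and leaves its length in [end_reg i]; the addition turns
    this into the end address. *)
Fixpoint levels (pars : seq nat) (i : nat) (c : cmd) : cmd :=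
  if pars is q :: pars' then
    Seq (Do (Neighbors (end_reg i) (end_reg i.-1) (val_reg q)))
   (Seq (Do (Add (end_reg i) (end_reg i.-1) (end_reg i)))
   (Seq (Do (Move (pos_reg i) (end_reg i.-1)))
        (WhileLt (pos_reg i) (end_reg i)
          (Seq (Do (Read (val_reg i) (pos_reg i)))
          (Seq (levels pars' i.+1 c)
               (Do (Add (pos_reg i) (pos_reg i) 1)))))))
  else c.

Section Levels.

Variables (p n : nat) (G : sgraph n) (I : presentation G).
Variables (c : cmd) (B : seq nat -> bool) (K D : nat) (w : seq nat -> seq nat).
Hypotheses (Hc : outputs_if p I c B K w) (D_gt0 : 0 < D) (degD : maxdeg G <= D).

(* The constant 8 pays for the overhead of one level, using [0 < D]. *)
Lemma levels_runs pars i s :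
    1 < i -> i + size pars = p -> (forall k, k < size pars -> nth 0 pars k < i + k) ->
    regs s 0 = 0 -> regs s 1 = 1 ->
  runs I (levels pars i c) s ((K + 8 * size pars) * D ^ size pars)
       [seq w xs | xs <- search (nbr_index I) pars (vals i s) & B xs]
       (frame (val_reg i) (regs s (end_reg i.-1)) s).
Proof.
elim: pars i s => [|q pars IH] i s i_gt1 /=.
  rewrite addn0 => -> _ s0 _; rewrite ?muln0 ?addn0 ?expn0 ?muln1.
  by have := @Hc s (regs s (end_reg p.-1)) s0; case: (B _).
move=> ip parsP s0 s1.
have lt_q : q < i by have := parsP 0 isT; rewrite addn0.
rewrite nth_vals //; set zs := nbr_index I _.
set b := regs s (end_reg i.-1); set xs := vals i s.
set L := (K + 8 * size pars) * D ^ size pars.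
have zsD : size zs <= D by apply: leq_trans (size_nbr_index _ _) degD.
(* At most [D] rounds of cost [L + 3], plus at most [D + 4] once, give [D * L + 4 * D + 4], which is
   at most [D * L + 8 * D]. *)
have cost_le : (size zs).+1 + (1 + (1 + (size zs * (1 + (L + 1)).+1).+1)) <=
               (K + 8 * (size pars).+1) * D ^ (size pars).+1.
  have X_gt0 : 0 < D ^ size pars by rewrite expn_gt0 D_gt0.
  have -> : (K + 8 * (size pars).+1) * D ^ (size pars).+1 = D * L + 8 * D * D ^ size pars.
    by rewrite /L expnS; lia.
  have : size zs * (1 + (L + 1)).+1 <= D * (L + 3) by apply: leq_mul => //; lia.
  have : 8 * D <= 8 * D * D ^ size pars by rewrite leq_pmulr.
  rewrite mulnDr; lia.
apply: runs_leq cost_le _.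
have regE : (pos_reg i == end_reg i = false) * (end_reg i == pos_reg i = false) *
            (end_reg i.-1 == end_reg i = false) * (end_reg i.-1 == pos_reg i = false) *
            (end_reg i == val_reg i = false) * (pos_reg i == val_reg i = false).
  by rewrite /pos_reg /end_reg /val_reg; do !split; apply/eqP; lia.
do 3!apply: runs_do_seq => //=.
set s' := set_reg _ _ _.
have s'_end : regs s' (end_reg i) = b + size zs.
  by rewrite /= /upd !regE !eqxx.
have s'_pos : regs s' (pos_reg i) = b.
  by rewrite /= /upd !regE !eqxx.
have s'_fr : frame (val_reg i) b s s'.
  split=> k lt_k /=; last by rewrite /upd_seq -/b leqNgt lt_k.
  by rewrite /upd; do !case: eqP => [E|_] //; move: lt_k; rewrite E /val_reg /end_reg /pos_reg; lia.
have s'_mem k : k < size zs -> Defs.mem s' (b + k) = nth 0 zs k.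
  by move=> lt_k; rewrite /= /upd_seq -/b leq_addr ltn_add2l lt_k addKn.
(* [ys] is the unread rest of the neighbor list, stored from the address in [pos_reg i] on. *)
pose inv (ys : seq nat) (r : state) := [/\ frame (val_reg i) b s r,
   regs r (end_reg i) = b + size zs, regs r (pos_reg i) + size ys = b + size zs &
   forall k, k < size ys -> Defs.mem r (regs r (pos_reg i) + k) = nth 0 ys k].
have -> : [seq w x | x <- flatten [seq search (nbr_index I) pars (rcons xs z) | z <- zs] & B x]
   = flatten [seq [seq w x | x <- search (nbr_index I) pars (rcons xs z) & B x] | z <- zs].
  by rewrite filter_flatten map_flatten -!map_comp.
have inv0 : inv zs s' by split; rewrite ?s'_pos.
apply: (runs_weaken (runs_while (I := I) (inv := inv) _ _ inv0)) => //; last by move=> r [].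
  by move=> r [_ -> <- _]; rewrite addn0.
move=> z ys r [r_fr r_end r_pos r_mem]; split; first by rewrite r_end -r_pos /= -addSnnS leq_addr.
apply: runs_do_seq => //.
set r1 := step _ _ _.
have r1_val : regs r1 (val_reg i) = z.
  by rewrite /= /upd eqxx; have := r_mem 0 isT; rewrite addn0.
have r1_reg k : k != val_reg i -> regs r1 k = regs r k.
  by move=> /negbTE ne; rewrite /= /upd ne.
have r1_fr : frame (val_reg i) b s r1.
  apply: frame_trans r_fr _; split=> // k lt_k; apply: r1_reg; apply/eqP => E.
  by rewrite E ltnn in lt_k.
have r1_01 : regs r1 0 = 0 /\ regs r1 1 = 1.
  by rewrite !r1_fr.1 // /val_reg; lia.
rewrite -[X in runs _ _ _ _ X]cats0.
(* The inner levels write only from [b + size zs] on, so the list being read survives. *)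
apply: (runs_seq (Q1 := frame (val_reg i.+1) (b + size zs) r1)).
  have := IH i.+1 r1; rewrite valsS r1_val (vals_frame r1_fr) ?leq_addr //.
  rewrite -[i.+1.-1]/i (r1_reg (end_reg i)) ?regE // r_end; case: r1_01 => r10 r11; apply=> //.
  - exact: ltnW.
  - by rewrite addSnnS.
  - by move=> k lt_k; rewrite addSnnS; apply: (parsP k.+1).
move=> r2 r2_fr; apply: runs_do => //.
have r2_reg k : k < val_reg i.+1 -> regs r2 k = regs r1 k by apply: r2_fr.1.
have lt_pe : (pos_reg i < val_reg i.+1) * (end_reg i < val_reg i.+1) * (1 < val_reg i.+1).
  by rewrite /pos_reg /end_reg /val_reg; do !split; lia.
split=> /=.
- apply: frame_trans r1_fr _; split=> k lt_k /=.
    rewrite /upd; case: eqP => [E|_]; first by move: lt_k; rewrite E /val_reg /pos_reg; lia.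
    by apply: r2_reg; move: lt_k; rewrite /val_reg; lia.
  by rewrite r2_fr.2 // (leq_trans lt_k) ?leq_addr.
- by rewrite /upd !regE r2_reg ?lt_pe // r1_reg ?regE.
- rewrite /upd eqxx !r2_reg ?lt_pe // r1_reg ?regE // r1_01.2 -r_pos /=; lia.
- move=> k lt_k; rewrite /upd eqxx !r2_reg ?lt_pe // r1_reg ?regE // r1_01.2.
  rewrite r2_fr.2; first by rewrite -addnA add1n; apply: (r_mem k.+1).
  by rewrite -r_pos /=; lia.
Qed.

End Levels.

(** * The outer loop over arcs and the whole program *)

Definition arc_loop (L : cmd) : cmd :=
  WhileLt (pos_reg 0) (end_reg 1)
    (Seq (Do (Read (val_reg 0) (pos_reg 0)))
    (Seq (Do (Add (pos_reg 0) (pos_reg 0) 1))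
    (Seq (Do (Read (val_reg 1) (pos_reg 0)))
    (Seq L
    (Seq (Do (Move (end_reg 0) (val_reg 0)))   (* [end_reg 0] is only used for this swap *)
    (Seq (Do (Move (val_reg 0) (val_reg 1)))
    (Seq (Do (Move (val_reg 1) (end_reg 0)))
    (Seq L
         (Do (Add (pos_reg 0) (pos_reg 0) 1)))))))))).

(** Register 0 is still 0, so the first read fetches [m]. Then [end_reg 1] becomes [2m + 1], the end
    of the edge list and the bottom of the stack. *)
Definition program (L : cmd) : cmd :=
  Seq (Do (Const 1 1))
 (Seq (Do (Read (end_reg 1) 0))
 (Seq (Do (Add (end_reg 1) (end_reg 1) (end_reg 1)))
 (Seq (Do (Add (end_reg 1) (end_reg 1) 1))
 (Seq (Do (Move (pos_reg 0) 1))
      (arc_loop L))))).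

Section Program.

Variables (n : nat) (G : sgraph n) (I : presentation G) (L : cmd) (T : nat).
Variable outputs : seq nat -> seq (seq nat).
Hypothesis L_runs : forall s, regs s 0 = 0 -> regs s 1 = 1 ->
  runs I L s T (outputs (vals 2 s)) (frame (val_reg 2) (regs s (end_reg 1)) s).

Definition endpoints (es : seq ('I_n * 'I_n)) : seq nat :=
  flatten [seq [:: val e.1; val e.2] | e <- es].

Definition unread (M : nat) (es : seq ('I_n * 'I_n)) (s : state) : Prop :=
  [/\ regs s 0 = 0, regs s 1 = 1, regs s (end_reg 1) = M,
      regs s (pos_reg 0) + 2 * size es = M &
      forall k, k < 2 * size es ->
        Defs.mem s (regs s (pos_reg 0) + k) = nth 0 (endpoints es) k].

Lemma arc_loop_runs M es s :
    unread M es s ->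
  runs I (arc_loop L) s (size es * (2 * T + 8)).+1
    (flatten [seq outputs [:: val e.1; val e.2] ++ outputs [:: val e.2; val e.1] | e <- es])
    (unread M [::]).
Proof.
(* One test, three instructions before each of the two runs of [L], and one final increment. *)
have -> : 2 * T + 8 = (3 + (T + (3 + (T + 1)))).+1 by lia.
apply: runs_while => [{}s [_ _ -> + _]|e {}es {}s [s0 s1 sM s_pos s_mem]].
  by rewrite addn0 => ->.
split; first by rewrite sM -s_pos /=; lia.
rewrite -[3 + _]/(1 + (1 + (1 + _))).
have m0 : Defs.mem s (regs s (pos_reg 0)) = e.1.
  by have := s_mem 0 isT; rewrite addn0.
have m1 : Defs.mem s (regs s (pos_reg 0) + 1) = e.2 by apply: (s_mem 1); rewrite /=; lia.
do 3!apply: runs_do_seq => //=.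
set r := set_reg _ _ _.
have r0 : regs r 0 = 0 by exact: s0.
have r1 : regs r 1 = 1 by exact: s1.
have r_end : regs r (end_reg 1) = M by exact: sM.
have r_pos : regs r (pos_reg 0) = (regs s (pos_reg 0)).+1.
  by rewrite /= /upd /= s1 addn1.
have r_v0 : regs r (val_reg 0) = e.1 by rewrite /= /upd /= m0.
have r_v1 : regs r (val_reg 1) = e.2 by rewrite /= /upd /= s1 m1.
have r_mem a : Defs.mem r a = Defs.mem s a by [].
clearbody r.
have := L_runs r0 r1; rewrite r_end /vals /= r_v0 r_v1 => L1.
apply: (runs_seq L1) => u [u_reg u_mem].
rewrite -[3 + _]/(1 + (1 + (1 + _))).
do 3!apply: runs_do_seq => //=.
set v := set_reg _ _ _.
have v0 : regs v 0 = 0 by rewrite /= /upd /= u_reg.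
have v1 : regs v 1 = 1 by rewrite /= /upd /= u_reg.
have v_end : regs v (end_reg 1) = M by rewrite /= /upd /= u_reg.
have v_pos : regs v (pos_reg 0) = (regs s (pos_reg 0)).+1.
  by rewrite /= /upd /= u_reg.
have v_v0 : regs v (val_reg 0) = e.2 by rewrite /= /upd /= u_reg.
have v_v1 : regs v (val_reg 1) = e.1 by rewrite /= /upd /= u_reg.
(* [L] writes only from address [M] on, beyond the edge list. *)
have v_mem a : a < M -> Defs.mem v a = Defs.mem s a.
  by move=> lt_a; rewrite -r_mem -u_mem.
clearbody v.
have := L_runs v0 v1; rewrite v_end /vals /= v_v0 v_v1 => L2.
rewrite -[outputs [:: nat_of_ord e.2; _]]cats0.
apply: (runs_seq L2) => x [x_reg x_mem].
apply: runs_do => //; split.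
- by rewrite /= /upd /= x_reg.
- by rewrite /= /upd /= x_reg.
- by rewrite /= /upd /= x_reg.
- by rewrite /= /upd /= !x_reg // v_pos v1 -s_pos /=; lia.
move=> k lt_k; have -> : regs (step I (Add (pos_reg 0) (pos_reg 0) 1) x) (pos_reg 0) =
    regs s (pos_reg 0) + 2.
  by rewrite /= /upd /= !x_reg // v_pos v1; lia.
rewrite /= x_mem ?v_mem -?s_pos /=; try by lia.
by rewrite -addnA s_mem //=; lia.
Qed.

Lemma program_runs :
  runs I (program L) (init I) (5 + (size (elist I) * (2 * T + 8)).+1)
    (flatten [seq outputs xs | xs <- arcs I]) (fun=> True).
Proof.
have -> : flatten [seq outputs xs | xs <- arcs I] =
    flatten [seq outputs [:: val e.1; val e.2] ++ outputs [:: val e.2; val e.1]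
            | e <- elist I].
  rewrite /arcs map_flatten -map_comp; elim: (elist I) => //= e es ->.
  by rewrite -catA.
rewrite -[5 + _]/(1 + (1 + (1 + (1 + (1 + _))))).
do 5!apply: runs_do_seq => //=.
set s := set_reg _ _ _; pose m := size (elist I).
apply: (runs_weaken (arc_loop_runs (M := m + m + 1) _)) => //.
split=> //=; first by rewrite /upd /= -/m; lia.
Qed.

End Program.

(** * Assembling the algorithm and its running time *)

Theorem theorem7p3 (p : nat) (S : sgraph p) (hp : 2 <= p) (hS : connected S) :
  exists (P : cmd) (C : nat),
    forall (Delta : nat -> nat) (n : nat) (G : sgraph n) (I : presentation G),
      maxdeg G <= Delta (nb_edges G) ->
      exists (t : nat) (s : state),
        [/\ exec I P (init I) t s,
            enumerates S G (out s) &
            0 < nb_edges G ->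
            t <= C * (nb_edges G * Delta (nb_edges G) ^ (p - 2))].
Proof.
case: hS => p_gt0 S_conn.
pose x0 : 'I_p := Ordinal p_gt0.
have [vs [vs_uniq vs_size vsP]] := search_order x0 S_conn.
pose emit := Do (Emit [seq val_reg (index j vs) | j <- enum 'I_p]).
pose check := foldr (guard p) emit (tests S vs).
pose K := sumn (map guard_cost (tests S vs)) + p.+1.
(* With [A = K + 8 * (p - 2)] and [X = D ^ (p - 2)], the time is at most
   [6 + m * (2 * (A * X) + 8)]. As [m] and [X] are positive, [14 * (m * X)] absorbs all but the main
   term. *)
exists (program (levels (parents S x0 vs) 2 check)), (2 * (K + 8 * (p - 2)) + 14).
move=> Delta n G I degG.
(* Without edges [Delta] may vanish, whereas the loop bounds need [0 < D]. *)
pose D := maxn 1 (Delta (nb_edges G)).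
have emit_ok : outputs_if p I emit (fun=> true) p.+1 (word vs).
  move=> s b _; exists p.+1, (step I (Emit [seq val_reg (index j vs) | j <- enum 'I_p]) s).
  split=> //=.
  - rewrite -[p in p.+1]size_enum_ord -(size_map (fun j => val_reg (index j vs))).
    exact: ExecDo.
  - rewrite cats1 -map_comp; congr rcons; apply: eq_map => j /=.
    by rewrite nth_vals ?index_vs_lt.
have check_ok := outputs_guards (ltn0Sn p) (tests_well_formed S vs_uniq vs_size) emit_ok.
have D_gt0 : 0 < D by rewrite leq_maxl.
have degD : maxdeg G <= D by rewrite leq_max degG orbT.
have szp := size_parents S x0 vs.
have parsP k : k < size (parents S x0 vs) -> nth 0 (parents S x0 vs) k < 2 + k.
  by rewrite szp => lt_k; have [] := parentsP hp vs_uniq vs_size vsP lt_k.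
have size_pars : 2 + size (parents S x0 vs) = p by rewrite szp subnKC.
have L_runs s := levels_runs check_ok D_gt0 degD (s := s) (isT : 1 < 2) size_pars parsP.
have [t [s [ex le_t os _]]] := program_runs (outputs := fun xs =>
  [seq word vs ys | ys <- search (nbr_index I) (parents S x0 vs) xs
                  & all (holds G ys) (tests S vs) && true]) L_runs.
exists t, s; split=> //.
  rewrite os /=.
  have := candidates_enumerate hp vs_uniq vs_size vsP I.
  rewrite /candidates filter_flatten map_flatten -!map_comp.
  congr (enumerates _ _ (flatten _)); apply: eq_map => xs /=.
  by congr map; apply: eq_filter => ys /=; rewrite andbT.
(* An endpoint of an edge has positive degree, so [Delta] is positive at [m] and the maximum with 1
   changes nothing. *)
move=> m_gt0; have DE : D = Delta (nb_edges G).
  apply/maxn_idPr/leq_trans/degG.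
  move: m_gt0; rewrite card_gt0 => /set0Pn[_ /edgesP[x [y [xy _]]]].
  apply: leq_trans (leq_bigmax (F := fun x => #|nbrs G x|) x).
  by rewrite card_gt0; apply/set0Pn; exists y; rewrite inE.
apply: leq_trans le_t _; rewrite size_elist szp -/K -DE.
have : 0 < D ^ (p - 2) by rewrite expn_gt0 D_gt0.
move: (nb_edges G) m_gt0 (D ^ _) (K + _) => m m_gt0 X A X_gt0.
have -> : (2 * A + 14) * (m * X) = m * (2 * (A * X) + 14 * X) by lia.
have : m * (2 * (A * X) + 14) <= m * (2 * (A * X) + 14 * X).
  by rewrite leq_mul2l leq_add2l leq_pmulr ?orbT.
by rewrite !mulnDr; lia.
Qed.
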